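(* Let $k$ be a field, let $G$ and $H$ be finite groups, and let $B_G$ and $B_H$ be blocks of the group algebras $kG$ and $kH$ respectively. Suppose that the $H\times G$-bimodule $M={}_HM_G$ defines a Morita equivalence between $B_G$ and $B_H$, and suppose that $M$ is self-dual as an $H\times G$-bimodule. Then a $B_G$-left module $V$ is self-dual if and only if $M\otimes_{kG}V$ is a self-dual $B_H$-left module.
   Context: An $H\times G$-bimodule is a $k$-vector space with a left $kH$-action and a commuting right $kG$-action. Its dual $M^*=\mathrm{Hom}_k(M,k)$ is an $H\times G$-bimodule via $(hfg)(m)=f(h^{-1}mg^{-1})$ for $h\in H$, $g\in G$, $f\in M^*$, $m\in M$; $M$ is called self-dual if $M\cong M^*$ as $H\times G$-bimodules. For a left $kG$-module $V$, the dual $V^*=\mathrm{Hom}_k(V,k)$ is the left $kG$-module with $(gf)(v)=f(g^{-1}v)$, and $V$ is self-dual if $V\cong V^*$ as left $kG$-modules (similarly for $H$). A block of $kG$ is an indecomposable two-sided direct factor of the algebra $kG$; modules over it are regarded as $kG$-modules. An $H\times G$-bimodule $M$ defines (or induces) a Morita equivalence between $B_G$ and $B_H$ if $M$ is a progenerator as a left $B_H$-module and as a right $B_G$-module and the functor $V\mapsto M\otimes_{kG}V$ is an equivalence from the category of left $B_G$-modules onto the category of left $B_H$-modules. *)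

(* Defs.v *)
From HB Require Import structures.
From mathcomp Require Import all_boot all_order all_fingroup all_algebra all_field.
From mathcomp Require Import generic_quotient boolp.

Set Implicit Arguments.
Unset Strict Implicit.
Unset Printing Implicit Defensive.

Import GRing.Theory.
Local Open Scope ring_scope.
Local Open Scope quotient_scope.

Record category := Category {
  obj :> Type;
  mor : obj -> obj -> Type;
  idm : forall X, mor X X;
  mcomp : forall X Y Z, mor Y Z -> mor X Y -> mor X Z;
  comp1m : forall X Y (f : mor X Y), mcomp (idm Y) f = f;
  compm1 : forall X Y (f : mor X Y), mcomp f (idm X) = f;
  compmA : forall X Y Z T (f : mor Z T) (g : mor Y Z) (h : mor X Y),
    mcomp f (mcomp g h) = mcomp (mcomp f g) h }.

Arguments idm {c} X.
Arguments mcomp {c X Y Z}.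

Record functor (C D : category) := Functor {
  fobj :> C -> D;
  fmap : forall X Y, mor X Y -> mor (fobj X) (fobj Y);
  fmap1 : forall X, fmap (idm X) = idm (fobj X);
  fmap_comp : forall X Y Z (f : mor Y Z) (g : mor X Y),
    fmap (mcomp f g) = mcomp (fmap f) (fmap g) }.

Arguments fmap {C D} F {X Y} : rename.

Definition functor_id (C : category) : functor C C :=
  @Functor C C id (fun _ _ f => f) (fun _ => erefl) (fun _ _ _ _ _ => erefl).

Section FunctorComp.
Variables (C D E : category) (F : functor D E) (G : functor C D).

Lemma functor_comp1 X : fmap F (fmap G (idm X)) = idm (F (G X)).
Proof. by rewrite !fmap1. Qed.

Lemma functor_compM X Y Z (f : mor Y Z) (g : mor X Y) :
  fmap F (fmap G (mcomp f g)) = mcomp (fmap F (fmap G f)) (fmap F (fmap G g)).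
Proof. by rewrite !fmap_comp. Qed.

Definition functor_comp : functor C E :=
  @Functor C E (fun X => F (G X)) (fun _ _ f => fmap F (fmap G f))
    functor_comp1 functor_compM.
End FunctorComp.

Definition is_iso (C : category) (X Y : C) (f : mor X Y) : Prop :=
  exists g : mor Y X, mcomp g f = idm X /\ mcomp f g = idm Y.

Definition nat_iso (C D : category) (F G : functor C D) : Prop :=
  exists eta : forall X : C, mor (F X) (G X),
    (forall X, is_iso (eta X)) /\
    (forall X Y (f : mor X Y), mcomp (eta Y) (fmap F f) = mcomp (fmap G f) (eta X)).

Definition is_equivalence (C D : category) (F : functor C D) : Prop :=
  exists G : functor D C,
    nat_iso (functor_comp G F) (functor_id C) /\
    nat_iso (functor_comp F G) (functor_id D).

Lemma linear_ext (R : pzRingType) (U : lmodType R) (V : zmodType)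
    (s : R -> V -> V) (f g : {linear U -> V | s}) : f =1 g -> f = g.
Proof.
case: f g => f [[f1] [f2]] [g [[g1] [g2]]] /= /funext fg; subst g.
by congr (GRing.Linear.Pack (GRing.Linear.Class _ _));
  congr (_ _); apply: Prop_irrelevance.
Qed.

Definition lmod_iso (R : pzRingType) (U V : lmodType R) : Prop :=
  exists f : {linear U -> V}, bijective f.

(* For a direct factor B of R with identity element e, a B-module is regarded as an
   R-module through the projection x |-> x e; the R-modules arising in this way
   are exactly those on which e acts as the identity. *)
Definition unital_at (R : nzRingType) (e : R) (V : lmodType R) : Prop :=
  forall v : V, e *: v = v.

Record umod (R : nzRingType) (e : R) := UMod {
  umod_sort :> lmodType R;
  umodP : unital_at e umod_sort }.

Section UModCat.
Variables (R : nzRingType) (e : R).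

Definition umod_hom (U V : umod e) := {linear U -> V}.
Definition umod_id (U : umod e) : umod_hom U U := idfun.
Definition umod_comp (U V W : umod e) (f : umod_hom V W) (g : umod_hom U V) :
  umod_hom U W := f \o g.

Lemma umod_comp1m U V (f : umod_hom U V) : umod_comp (umod_id V) f = f.
Proof. exact: linear_ext. Qed.
Lemma umod_compm1 U V (f : umod_hom U V) : umod_comp f (umod_id U) = f.
Proof. exact: linear_ext. Qed.
Lemma umod_compmA U V W X (f : umod_hom W X) (g : umod_hom V W)
    (h : umod_hom U V) :
  umod_comp f (umod_comp g h) = umod_comp (umod_comp f g) h.
Proof. exact: linear_ext. Qed.

Definition umod_cat : category :=
  Category umod_comp1m umod_compm1 umod_compmA.
End UModCat.

Section Progenerator.
Variables (R : nzRingType) (e : R) (P : lmodType R).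

Definition fin_generated : Prop :=
  exists n (s : 'I_n -> P),
    forall x, exists c : 'I_n -> R, x = \sum_(i < n) c i *: s i.

(* Projectivity and the generator property are those in the category of modules
   on which e acts as the identity. *)
Definition projective : Prop :=
  forall X Y : lmodType R, unital_at e X -> unital_at e Y ->
  forall (g : {linear X -> Y}) (f : {linear P -> Y}),
    (forall y, exists x, g x = y) ->
    exists h : {linear P -> X}, forall p, g (h p) = f p.

Definition generator : Prop :=
  forall X : lmodType R, unital_at e X -> forall x : X,
    exists n (f : 'I_n -> {linear P -> X}) (p : 'I_n -> P),
      x = \sum_(i < n) f i (p i).

Definition progenerator : Prop :=
  [/\ unital_at e P, fin_generated, projective & generator].
End Progenerator.

(* ract_scalar: k acts in the same way through S and through R. *)
Record bimod (k : fieldType) (S R : algType k) := Bimod {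
  bimod_sort :> lmodType S;
  ract : bimod_sort -> R -> bimod_sort;
  ractDl : forall m n r, ract (m + n) r = ract m r + ract n r;
  ractDr : forall m r s, ract m (r + s) = ract m r + ract m s;
  ract1 : forall m, ract m 1 = m;
  ractM : forall m r s, ract m (r * s) = ract (ract m r) s;
  ractZ : forall a m r, ract (a *: m) r = a *: ract m r;
  ract_scalar : forall m (c : k), ract m c%:A = c%:A *: m }.

Notation "m <* r" := (ract m r) (at level 40, left associativity) : ring_scope.

Section BimodTheory.
Variables (k : fieldType) (S R : algType k) (M : bimod S R).

Lemma ract0l (r : R) : 0 <* r = 0 :> M.
Proof. by apply: (addrI (0 <* r)); rewrite -ractDl !addr0. Qed.

Lemma ractNl (m : M) (r : R) : (- m) <* r = - (m <* r).
Proof. by apply/eqP; rewrite -addr_eq0 -ractDl addNr ract0l. Qed.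
End BimodTheory.

(* The right R-module underlying M, as a left module over the converse ring. *)
Section RightModule.
Variables (k : fieldType) (S R : algType k).

Definition right_mod (M : bimod S R) : Type := M.

Variable M : bimod S R.
HB.instance Definition _ := GRing.Zmodule.on (right_mod M).

Definition right_scale (r : R^c) (m : right_mod M) : right_mod M := ract (m : M) r.

Lemma right_scaleA a b m :
  right_scale a (right_scale b m) = right_scale (a * b) m.
Proof. by rewrite /right_scale -ractM. Qed.
Lemma right_scale1 : left_id 1 right_scale.
Proof. by move=> m; rewrite /right_scale ract1. Qed.
Lemma right_scaleDr : right_distributive right_scale +%R.
Proof. by move=> r m n; rewrite /right_scale ractDl. Qed.
Lemma right_scaleDl m : {morph right_scale^~ m : a b / a + b}.
Proof. by move=> r s; rewrite /right_scale ractDr. Qed.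

HB.instance Definition _ := GRing.Zmodule_isLmodule.Build R^c (right_mod M)
  right_scaleA right_scale1 right_scaleDr right_scaleDl.
End RightModule.

Section Tensor.
Variables (k : fieldType) (S R : algType k) (M : bimod S R) (V : lmodType R).

(* A word [:: (m1, v1); ...; (mn, vn)] stands for m1 (x) v1 + ... + mn (x) vn.
   The tensor product is the commutative monoid presented by the generators
   m (x) v and the relations below; it is a group since - (m (x) v) is
   (- m) (x) v. *)
Inductive tensor_eq : seq (M * V) -> seq (M * V) -> Prop :=
| tensor_refl s : tensor_eq s s
| tensor_sym s t : tensor_eq s t -> tensor_eq t s
| tensor_trans s t u : tensor_eq s t -> tensor_eq t u -> tensor_eq s u
| tensor_cat s s' t t' :
    tensor_eq s s' -> tensor_eq t t' -> tensor_eq (s ++ t) (s' ++ t')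
| tensor_catC s t : tensor_eq (s ++ t) (t ++ s)
| tensor_0 v : tensor_eq [:: (0, v)] [::]
| tensor_Dl m n v : tensor_eq [:: (m + n, v)] [:: (m, v); (n, v)]
| tensor_Dr m v w : tensor_eq [:: (m, v + w)] [:: (m, v); (m, w)]
| tensor_bal m r v : tensor_eq [:: (m <* r, v)] [:: (m, r *: v)].

Definition tensor_rel (s t : seq (M * V)) : bool := `[< tensor_eq s t >].

Lemma tensor_rel_refl : reflexive tensor_rel.
Proof. by move=> s; apply/asboolP/tensor_refl. Qed.
Lemma tensor_rel_sym : symmetric tensor_rel.
Proof. by move=> s t; apply/asboolP/asboolP; apply: tensor_sym. Qed.
Lemma tensor_rel_trans : transitive tensor_rel.
Proof.
by move=> t s u /asboolP st /asboolP tu; apply/asboolP/(tensor_trans st tu).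
Qed.

Canonical tensor_equiv :=
  EquivRel tensor_rel tensor_rel_refl tensor_rel_sym tensor_rel_trans.

Definition tensor : Type := {eq_quot tensor_equiv}.
HB.instance Definition _ := Choice.on tensor.
HB.instance Definition _ := EqQuotient.on tensor.

Definition tensor_of (s : seq (M * V)) : tensor := \pi_tensor s.

Lemma tensor_ofP s t : tensor_of s = tensor_of t <-> tensor_eq s t.
Proof. by split=> [/eqmodP/asboolP|st] //; apply/eqmodP/asboolP. Qed.

Lemma tensor_ofK (x : tensor) : tensor_of (repr x) = x.
Proof. exact: reprK. Qed.

Lemma repr_tensor_of s : tensor_eq (repr (tensor_of s)) s.
Proof. by apply/tensor_ofP; rewrite tensor_ofK. Qed.

Lemma tensor_ind (P : tensor -> Prop) :
  (forall s, P (tensor_of s)) -> forall x, P x.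
Proof. by move=> Ps x; rewrite -(tensor_ofK x). Qed.

Definition word_opp : seq (M * V) -> seq (M * V) := map (fun p => (- p.1, p.2)).
Definition word_scale (a : S) : seq (M * V) -> seq (M * V) :=
  map (fun p => (a *: p.1, p.2)).

Lemma word_map_eq (f : M -> M) :
    f 0 = 0 -> {morph f : m n / m + n} -> (forall m r, f (m <* r) = f m <* r) ->
  forall s t, tensor_eq s t ->
  tensor_eq (map (fun p => (f p.1, p.2)) s) (map (fun p => (f p.1, p.2)) t).
Proof.
move=> f0 fD fr s t; elim=> {s t} /=.
- by move=> s; apply: tensor_refl.
- by move=> s t _; apply: tensor_sym.
- by move=> s t u _ st _; apply: tensor_trans.
- by move=> s s' t t' _ ss' _ tt'; rewrite !map_cat; apply: tensor_cat.
- by move=> s t; rewrite !map_cat; apply: tensor_catC.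
- by move=> v; rewrite f0; apply: tensor_0.
- by move=> m n v; rewrite fD; apply: tensor_Dl.
- by move=> m v w; apply: tensor_Dr.
- by move=> m r v; rewrite fr; apply: tensor_bal.
Qed.

Lemma word_opp_eq s t : tensor_eq s t -> tensor_eq (word_opp s) (word_opp t).
Proof.
by apply: (word_map_eq (f := -%R)); [exact: oppr0 | exact: opprD | move=> m r; rewrite ractNl].
Qed.

Lemma word_scale_eq a s t :
  tensor_eq s t -> tensor_eq (word_scale a s) (word_scale a t).
Proof.
by apply: word_map_eq; [exact: scaler0 | exact: scalerDr | move=> m r; rewrite ractZ].
Qed.

Definition tensor_zero : tensor := tensor_of [::].
Definition tensor_add (x y : tensor) : tensor := tensor_of (repr x ++ repr y).
Definition tensor_opp (x : tensor) : tensor := tensor_of (word_opp (repr x)).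
Definition tensor_scale (a : S) (x : tensor) : tensor :=
  tensor_of (word_scale a (repr x)).

Lemma tensor_addE s t :
  tensor_add (tensor_of s) (tensor_of t) = tensor_of (s ++ t).
Proof. by apply/tensor_ofP/tensor_cat; apply: repr_tensor_of. Qed.

Lemma tensor_oppE s : tensor_opp (tensor_of s) = tensor_of (word_opp s).
Proof. by apply/tensor_ofP/word_opp_eq; apply: repr_tensor_of. Qed.

Lemma tensor_scaleE a s :
  tensor_scale a (tensor_of s) = tensor_of (word_scale a s).
Proof. by apply/tensor_ofP/word_scale_eq; apply: repr_tensor_of. Qed.

Lemma tensor_addA : associative tensor_add.
Proof.
elim/tensor_ind=> s; elim/tensor_ind=> t; elim/tensor_ind=> u.
by rewrite !tensor_addE catA.
Qed.

Lemma tensor_addC : commutative tensor_add.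
Proof.
elim/tensor_ind=> s; elim/tensor_ind=> t; rewrite !tensor_addE.
exact/tensor_ofP/tensor_catC.
Qed.

Lemma tensor_add0 : left_id tensor_zero tensor_add.
Proof. by elim/tensor_ind=> s; rewrite tensor_addE. Qed.

Lemma tensor_addN : left_inverse tensor_zero tensor_opp tensor_add.
Proof.
elim/tensor_ind=> s; rewrite tensor_oppE tensor_addE; apply/tensor_ofP.
elim: s => [|[m v] s IHs] /=; first exact: tensor_refl.
apply: (@tensor_trans _ ([:: (- m, v); (m, v)] ++ (word_opp s ++ s))).
  apply: (@tensor_cat [:: (- m, v)] [:: (- m, v)] _ ((m, v) :: word_opp s ++ s)).
    exact: tensor_refl.
  rewrite -(cat1s _ s) -(cat1s _ (_ ++ s)) !catA; apply: tensor_cat.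
    exact: tensor_catC.
  exact: tensor_refl.
rewrite -[X in tensor_eq _ X]cats0; apply: (@tensor_cat _ [::]) => //.
apply: tensor_trans (tensor_sym (tensor_Dl _ _ _)) _; rewrite addNr.
exact: tensor_0.
Qed.

HB.instance Definition _ := GRing.isZmodule.Build tensor
  tensor_addA tensor_addC tensor_add0 tensor_addN.

Lemma tensor_scaleA a b x :
  tensor_scale a (tensor_scale b x) = tensor_scale (a * b) x.
Proof.
elim/tensor_ind: x => s; rewrite !tensor_scaleE; congr tensor_of.
by rewrite /word_scale -map_comp; apply: eq_map => p /=; rewrite scalerA.
Qed.

Lemma tensor_scale1 : left_id 1 tensor_scale.
Proof.
elim/tensor_ind=> s; rewrite tensor_scaleE; congr tensor_of.
by rewrite -[RHS]map_id; apply: eq_map => -[m v] /=; rewrite scale1r.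
Qed.

Lemma tensor_scaleDr : right_distributive tensor_scale +%R.
Proof.
move=> a; elim/tensor_ind=> s; elim/tensor_ind=> t.
by rewrite /GRing.add /= !(tensor_scaleE, tensor_addE) /word_scale map_cat.
Qed.

Lemma tensor_scaleDl x : {morph tensor_scale^~ x : a b / a + b}.
Proof.
move=> a b /=; elim/tensor_ind: x => s; rewrite !tensor_scaleE.
rewrite [RHS]tensor_addE; apply/tensor_ofP.
elim: s => [|[m v] s IHs] /=; first exact: tensor_refl.
apply: (@tensor_trans _ ([:: (a *: m, v); (b *: m, v)] ++
                          (word_scale a s ++ word_scale b s))).
  rewrite -cat1s scalerDl; apply: tensor_cat IHs; exact: tensor_Dl.
apply: (@tensor_cat [:: (a *: m, v)] [:: (a *: m, v)] (_ :: _)).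
  exact: tensor_refl.
rewrite -(cat1s _ (_ ++ _)) -(cat1s _ (word_scale b s)) !catA.
by apply: tensor_cat (tensor_catC _ _) (tensor_refl _).
Qed.

HB.instance Definition _ := GRing.Zmodule_isLmodule.Build S tensor
  tensor_scaleA tensor_scale1 tensor_scaleDr tensor_scaleDl.

Definition pure_tensor (m : M) (v : V) : tensor := tensor_of [:: (m, v)].

Lemma tensor_of_sum s :
  tensor_of s = \sum_(p <- s) pure_tensor p.1 p.2.
Proof.
elim: s => [|[m v] s IHs]; first by rewrite big_nil.
by rewrite big_cons -IHs -cat1s [RHS]tensor_addE.
Qed.

Lemma tensor_unital (e : S) : unital_at e M -> unital_at e (tensor : lmodType S).
Proof.
move=> eM; elim/tensor_ind=> s; rewrite [LHS]tensor_scaleE; congr tensor_of.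
by rewrite -[RHS]map_id; apply: eq_map => -[m v] /=; rewrite eM.
Qed.
End Tensor.

Section TensorMap.
Variables (k : fieldType) (S R : algType k) (M : bimod S R).
Variables (V W : lmodType R) (f : {linear V -> W}).

Definition word_map : seq (M * V) -> seq (M * W) := map (fun p => (p.1, f p.2)).

Lemma word_map_tensor_eq s t :
  tensor_eq s t -> tensor_eq (word_map s) (word_map t).
Proof.
elim=> {s t} /=.
- by move=> s; apply: tensor_refl.
- by move=> s t _; apply: tensor_sym.
- by move=> s t u _ st _; apply: tensor_trans.
- by move=> s s' t t' _ ss' _ tt'; rewrite /word_map !map_cat; apply: tensor_cat.
- by move=> s t; rewrite /word_map !map_cat; apply: tensor_catC.
- by move=> v; apply: tensor_0.
- by move=> m n v; apply: tensor_Dl.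
- by move=> m v w; rewrite linearD; apply: tensor_Dr.
- by move=> m r v; rewrite linearZ; apply: tensor_bal.
Qed.

Definition tensor_map (x : tensor M V) : tensor M W :=
  tensor_of (word_map (repr x)).

Lemma tensor_mapE s : tensor_map (tensor_of s) = tensor_of (word_map s).
Proof. by apply/tensor_ofP/word_map_tensor_eq/repr_tensor_of. Qed.

Lemma tensor_map_pure m v :
  tensor_map (pure_tensor m v) = pure_tensor m (f v).
Proof. exact: tensor_mapE. Qed.

Lemma tensor_map_linear : linear tensor_map.
Proof.
move=> a; elim/tensor_ind=> s; elim/tensor_ind=> t.
rewrite /GRing.scale /GRing.add /=.
rewrite !(tensor_scaleE, tensor_addE, tensor_mapE); congr tensor_of.
by rewrite /word_map /word_scale map_cat -!map_comp.
Qed.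

HB.instance Definition _ := GRing.isLinear.Build S (tensor M V) (tensor M W)
  _ tensor_map tensor_map_linear.
End TensorMap.
Arguments tensor_map {k S R} M {V W} f x.

Section TensorFunctor.
Variables (k : fieldType) (S R : algType k) (M : bimod S R) (eS : S) (eR : R).
Hypothesis eM : unital_at eS M.

Definition tensor_umod (V : umod eR) : umod eS :=
  UMod (@tensor_unital _ _ _ M V eS eM).

Definition tensor_umod_map (V W : umod eR) (f : {linear V -> W}) :
  {linear tensor_umod V -> tensor_umod W} := tensor_map M f.

Lemma tensor_umod_map1 (V : umod eR) :
  tensor_umod_map (umod_id V) = umod_id (tensor_umod V).
Proof.
apply: linear_ext; elim/tensor_ind=> s; rewrite [LHS]tensor_mapE /=.
by congr tensor_of; rewrite -[RHS]map_id; apply: eq_map => -[].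
Qed.

Lemma tensor_umod_map_comp (U V W : umod eR) (f : umod_hom V W)
    (g : umod_hom U V) :
  tensor_umod_map (umod_comp f g) =
    umod_comp (tensor_umod_map f) (tensor_umod_map g).
Proof.
apply: linear_ext; elim/tensor_ind=> s /=.
by rewrite !tensor_mapE /word_map -map_comp.
Qed.

Definition tensor_functor : functor (umod_cat eR) (umod_cat eS) :=
  @Functor (umod_cat eR) (umod_cat eS) tensor_umod tensor_umod_map
    tensor_umod_map1 tensor_umod_map_comp.
End TensorFunctor.

(* M induces an equivalence from modules over the direct factor of R with
   identity element f to those over the direct factor of S with identity e. *)
Definition defines_morita (k : fieldType) (S R : algType k) (e : S) (f : R)
    (M : bimod S R) : Prop :=
  [/\ progenerator e M, progenerator (f : R^c) (right_mod M) &
      exists eM : unital_at e M, is_equivalence (tensor_functor f eM)].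

Section GroupAlgebra.
Variables (k : fieldType) (G : finGroupType).

Definition galg : Type := {ffun G -> k^o}.
HB.instance Definition _ := Vector.on galg.

Definition gelt (g : G) : galg := [ffun x => (x == g)%:R].
Definition galg_mul (a b : galg) : galg :=
  [ffun x => \sum_y a y * b (y^-1 * x)%g].

Lemma galg_mulA : associative galg_mul.
Proof.
move=> a b c; apply/ffunP=> x; rewrite !ffunE.
under eq_bigr do rewrite ffunE big_distrr /=.
under [RHS]eq_bigr do rewrite ffunE big_distrl /=.
rewrite [RHS]exchange_big; apply: eq_bigr => y _ /=.
rewrite [RHS](reindex_inj (mulgI y)); apply: eq_bigr => z _ /=.
by rewrite mulrA mulKg invMg mulgA.
Qed.

Lemma galg_mul1 : left_id (gelt 1%g) galg_mul.
Proof.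
move=> a; apply/ffunP=> x; rewrite ffunE (bigD1 1%g) //= big1 => [|y /negPf y1].
  by rewrite ffunE eqxx mul1r invg1 mul1g addr0.
by rewrite ffunE y1 mul0r.
Qed.

Lemma galg_1mul : right_id (gelt 1%g) galg_mul.
Proof.
move=> a; apply/ffunP=> x; rewrite ffunE (bigD1 x) //= big1 => [|y /negPf yx].
  by rewrite ffunE mulVg eqxx mulr1 addr0.
by rewrite ffunE -eq_mulVg1 yx mulr0.
Qed.

Lemma galg_mulDl : left_distributive galg_mul +%R.
Proof.
move=> a b c; apply/ffunP=> x; rewrite !ffunE -big_split.
by apply: eq_bigr => y _; rewrite ffunE mulrDl.
Qed.

Lemma galg_mulDr : right_distributive galg_mul +%R.
Proof.
move=> a b c; apply/ffunP=> x; rewrite !ffunE -big_split.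
by apply: eq_bigr => y _; rewrite ffunE mulrDr.
Qed.

Lemma galg_1neq0 : gelt 1%g != 0.
Proof.
by apply/eqP=> /ffunP/(_ 1%g)/eqP; rewrite !ffunE eqxx oner_eq0.
Qed.

HB.instance Definition _ := GRing.Zmodule_isNzRing.Build galg
  galg_mulA galg_mul1 galg_1mul galg_mulDl galg_mulDr galg_1neq0.

Lemma galg_scaleAl (c : k) (a b : galg) : c *: (a * b) = (c *: a) * b.
Proof.
apply/ffunP=> x; rewrite !ffunE [LHS]big_distrr /=.
by apply: eq_bigr => y _; rewrite ffunE; apply: mulrA.
Qed.

HB.instance Definition _ := GRing.Lmodule_isLalgebra.Build k galg galg_scaleAl.

Lemma galg_scaleAr (c : k) (a b : galg) : c *: (a * b) = a * (c *: b).
Proof.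
apply/ffunP=> x; rewrite !ffunE [LHS]big_distrr /=.
by apply: eq_bigr => y _; rewrite ffunE; apply: mulrCA.
Qed.

HB.instance Definition _ := GRing.Lalgebra_isAlgebra.Build k galg galg_scaleAr.
HB.instance Definition _ := Algebra_isFalgebra.Build k galg.

Lemma geltM (g h : G) : gelt g * gelt h = gelt (g * h).
Proof.
apply/ffunP=> x; rewrite !ffunE (bigD1 g) //= big1 => [|y /negPf yg].
  by rewrite !ffunE eqxx mul1r addr0 (can2_eq (mulKVg g) (mulKg g)).
by rewrite !ffunE yg mul0r.
Qed.
End GroupAlgebra.

Section Block.
Variables (k : fieldType) (A : falgType k).
Local Open Scope vspace_scope.

Definition two_sided_ideal (I : {vspace A}) : bool :=
  (fullv * I <= I) && (I * fullv <= I).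

(* An {aspace A} is a multiplicatively closed nonzero subspace of A having an
   identity element (algid B), as every nonzero direct factor of A does. *)
Definition is_block (B : {aspace A}) : Prop :=
  [/\ two_sided_ideal B,
      exists C : {vspace A},
        [/\ two_sided_ideal C, B + C = fullv & B :&: C = 0] &
      forall I J : {vspace A}, two_sided_ideal I -> two_sided_ideal J ->
        I + J = B -> I :&: J = 0 -> I = 0 \/ J = 0].
End Block.

(* The k-vector space underlying a module over a k-algebra. *)
Section Restriction.
Variables (k : fieldType) (A : algType k).

Definition restr (V : lmodType A) : Type := V.

Variable V : lmodType A.
HB.instance Definition _ := GRing.Zmodule.on (restr V).

Definition restr_scale (c : k) (v : restr V) : restr V := c%:A *: (v : V).

Lemma restr_scaleA a b v :
  restr_scale a (restr_scale b v) = restr_scale (a * b) v.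
Proof. by rewrite /restr_scale scalerA -scalerAl mul1r scalerA. Qed.
Lemma restr_scale1 : left_id 1 restr_scale.
Proof. by move=> v; rewrite /restr_scale !scale1r. Qed.
Lemma restr_scaleDr : right_distributive restr_scale +%R.
Proof. by move=> c v w; rewrite /restr_scale scalerDr. Qed.
Lemma restr_scaleDl v : {morph restr_scale^~ v : a b / a + b}.
Proof. by move=> a b; rewrite /restr_scale !scalerDl. Qed.

HB.instance Definition _ := GRing.Zmodule_isLmodule.Build k (restr V)
  restr_scaleA restr_scale1 restr_scaleDr restr_scaleDl.
End Restriction.

Section Dual.
Variables (k : fieldType) (G : finGroupType) (V : lmodType (galg k G)).

Record dual : Type := Dual { dual_fun :> {linear restr V -> k^o} }.

HB.instance Definition _ := gen_eqMixin dual.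
HB.instance Definition _ := gen_choiceMixin dual.

Lemma dualP (f g : dual) : (forall v, f v = g v) -> f = g.
Proof. by case: f g => f [g] fg; congr Dual; apply: linear_ext. Qed.

Lemma dualD (f : dual) (v w : V) : f (v + w) = f v + f w.
Proof. exact: (linearD f (v : restr V)). Qed.

Lemma dualZ (f : dual) (c : k) (v : V) : f (c%:A *: v) = c * f v.
Proof.
exact: (linearZ_LR f c (v : restr V)).
Qed.

Definition dual_zero : dual := Dual (\0 : {linear restr V -> k^o}).
Definition dual_add (f g : dual) : dual :=
  Dual (dual_fun f \+ dual_fun g : {linear restr V -> k^o}).
Definition dual_opp (f : dual) : dual :=
  Dual (\- (dual_fun f) : {linear restr V -> k^o}).

Lemma dual_addA : associative dual_add.
Proof. by move=> f g h; apply: dualP => v; apply: addrA. Qed.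
Lemma dual_addC : commutative dual_add.
Proof. by move=> f g; apply: dualP => v; apply: addrC. Qed.
Lemma dual_add0 : left_id dual_zero dual_add.
Proof. by move=> f; apply: dualP => v; apply: add0r. Qed.
Lemma dual_addN : left_inverse dual_zero dual_opp dual_add.
Proof. by move=> f; apply: dualP => v; apply: addNr. Qed.

HB.instance Definition _ := GRing.isZmodule.Build dual
  dual_addA dual_addC dual_add0 dual_addN.

Lemma dual_addE (f g : dual) v : (f + g) v = f v + g v.
Proof. by []. Qed.

(* The action (g f)(v) = f(g^-1 v) of G, extended linearly to the group
   algebra. *)
Definition dual_scale_fun (a : galg k G) (f : dual) : restr V -> k^o :=
  fun v => \sum_g a g * f (gelt k g^-1%g *: (v : V)).

Lemma galg_scaleC (c : k) (b : galg k G) (v : V) :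
  b *: (c%:A *: v) = c%:A *: (b *: v).
Proof. by rewrite !scalerA -scalerAr -scalerAl mulr1 mul1r. Qed.

Lemma dual_scale_fun_linear a f : linear (dual_scale_fun a f).
Proof.
move=> c u v; rewrite [LHS]/dual_scale_fun [c *: u]/GRing.scale /=.
rewrite [c *: dual_scale_fun _ _ _]big_distrr -big_split; apply: eq_bigr => g _ /=.
by rewrite scalerDr dualD galg_scaleC dualZ mulrDr mulrCA.
Qed.

HB.instance Definition _ a f := GRing.isLinear.Build k (restr V) k^o _
  (dual_scale_fun a f) (dual_scale_fun_linear a f).

Definition dual_scale (a : galg k G) (f : dual) : dual :=
  Dual (dual_scale_fun a f : {linear restr V -> k^o}).

Lemma dual_scaleE a f v :
  dual_scale a f v = \sum_g a g * f (gelt k g^-1%g *: v).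
Proof. by []. Qed.

Lemma dual_scaleA a b f :
  dual_scale a (dual_scale b f) = dual_scale (a * b) f.
Proof.
apply: dualP => v; rewrite !dual_scaleE.
under eq_bigr do rewrite dual_scaleE big_distrr /=.
under [RHS]eq_bigr do rewrite ffunE big_distrl /=.
rewrite [RHS]exchange_big; apply: eq_bigr => x _ /=.
rewrite [RHS](reindex_inj (mulgI x)); apply: eq_bigr => y _ /=.
by rewrite mulKg mulrA scalerA geltM invMg.
Qed.

Lemma dual_scale1 : left_id 1 dual_scale.
Proof.
move=> f; apply: dualP => v; rewrite !dual_scaleE.
rewrite (bigD1 1%g) //= big1 => [|g /negPf g1].
  by rewrite ffunE eqxx mul1r invg1 addr0 scale1r.
by rewrite ffunE g1 mul0r.
Qed.

Lemma dual_scaleDr : right_distributive dual_scale +%R.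
Proof.
move=> a f g; apply: dualP => v.
rewrite dual_addE !dual_scaleE -big_split.
by apply: eq_bigr => x _; rewrite dual_addE mulrDr.
Qed.

Lemma dual_scaleDl f : {morph dual_scale^~ f : a b / a + b}.
Proof.
move=> a b; apply: dualP => v.
rewrite dual_addE !dual_scaleE -big_split.
by apply: eq_bigr => x _; rewrite ffunE mulrDl.
Qed.

HB.instance Definition _ := GRing.Zmodule_isLmodule.Build (galg k G) dual
  dual_scaleA dual_scale1 dual_scaleDr dual_scaleDl.

Lemma dual_geltE (g : G) (f : dual) (v : V) :
  (gelt k g *: f) v = f (gelt k g^-1%g *: v).
Proof.
rewrite [LHS]dual_scaleE (bigD1 g) //= big1 => [|x /negPf xg].
  by rewrite ffunE eqxx mul1r addr0.
by rewrite ffunE xg mul0r.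
Qed.

Definition self_dual : Prop := lmod_iso V dual.
End Dual.

Section DualBimod.
Variables (k : fieldType) (H G : finGroupType).
Variable M : bimod (galg k H) (galg k G).

(* The action (f g)(m) = f(m g^-1) of G, extended linearly. *)
Definition dual_ract_fun (f : dual M) (a : galg k G) : restr M -> k^o :=
  fun m => \sum_g a g * f ((m : M) <* gelt k g^-1%g).

Lemma dual_ract_fun_linear f a : linear (dual_ract_fun f a).
Proof.
move=> c u v; rewrite [LHS]/dual_ract_fun [c *: u]/GRing.scale /=.
rewrite [c *: dual_ract_fun _ _ _]big_distrr -big_split; apply: eq_bigr => g _ /=.
by rewrite ractDl dualD ractZ dualZ mulrDr mulrCA.
Qed.

HB.instance Definition _ f a := GRing.isLinear.Build k (restr M) k^o _
  (dual_ract_fun f a) (dual_ract_fun_linear f a).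

Definition dual_ract (f : dual M) (a : galg k G) : dual M :=
  Dual (dual_ract_fun f a : {linear restr M -> k^o}).

Lemma dual_ractE f a m :
  dual_ract f a m = \sum_g a g * f (m <* gelt k g^-1%g).
Proof. by []. Qed.

Lemma dual_ractDl f g a :
  dual_ract (f + g) a = dual_ract f a + dual_ract g a.
Proof.
apply: dualP => m.
rewrite dual_addE !dual_ractE -big_split.
by apply: eq_bigr => x _; rewrite dual_addE mulrDr.
Qed.

Lemma dual_ractDr f a b :
  dual_ract f (a + b) = dual_ract f a + dual_ract f b.
Proof.
apply: dualP => m.
rewrite dual_addE !dual_ractE -big_split.
by apply: eq_bigr => x _; rewrite ffunE mulrDl.
Qed.

Lemma dual_ract_gelt f g m : dual_ract f (gelt k g) m = f (m <* gelt k g^-1%g).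
Proof.
rewrite dual_ractE (bigD1 g) //= big1 => [|x /negPf xg].
  by rewrite ffunE eqxx mul1r addr0.
by rewrite ffunE xg mul0r.
Qed.

Lemma dual_ract1 f : dual_ract f 1 = f.
Proof. by apply: dualP => m; rewrite dual_ract_gelt invg1 ract1. Qed.

Lemma dual_ractM f a b : dual_ract f (a * b) = dual_ract (dual_ract f a) b.
Proof.
apply: dualP => m; rewrite !dual_ractE.
under eq_bigr do rewrite ffunE big_distrl /=.
under [RHS]eq_bigr do rewrite dual_ractE big_distrr /=.
rewrite exchange_big [RHS]exchange_big; apply: eq_bigr => x _ /=.
rewrite (reindex_inj (mulgI x)); apply: eq_bigr => y _ /=.
by rewrite mulKg -mulrA mulrCA -ractM geltM invMg.
Qed.

Lemma dual_ractZ a f b : dual_ract (a *: f) b = a *: dual_ract f b.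
Proof.
apply: dualP => m; rewrite dual_ractE [RHS]dual_scaleE.
under eq_bigr do rewrite [X in _ * X]dual_scaleE big_distrr /=.
under [RHS]eq_bigr do rewrite dual_ractE big_distrr /=.
rewrite exchange_big; apply: eq_bigr => x _ /=; apply: eq_bigr => y _ /=.
by rewrite mulrCA ractZ.
Qed.

Lemma dual_ract_scalar f (c : k) : dual_ract f c%:A = c%:A *: f.
Proof.
apply: dualP => m; rewrite dual_ractE [RHS]dual_scaleE.
have E (K : finGroupType) (F : K -> k) :
  \sum_g (c%:A : galg k K) g * F g = c * F 1%g.
  rewrite (bigD1 1%g) //= big1 => [|x /negPf x1].
    by rewrite !ffunE eqxx addr0 [c *: _]mulr1.
  by rewrite !ffunE x1 [c *: _]mulr0 mul0r.
by rewrite !E invg1 ract1 invg1 scale1r.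
Qed.

Definition dual_bimod : bimod (galg k H) (galg k G) :=
  Bimod dual_ractDl dual_ractDr dual_ract1 dual_ractM dual_ractZ
    dual_ract_scalar.
End DualBimod.

Definition bimod_iso (k : fieldType) (S R : algType k) (M N : bimod S R) : Prop :=
  exists f : {linear M -> N},
    bijective f /\ forall m r, f (m <* r) = f m <* r.

Definition bimod_self_dual (k : fieldType) (H G : finGroupType)
    (M : bimod (galg k H) (galg k G)) : Prop :=
  bimod_iso M (dual_bimod M).

(* Main.v *)
Require Import Defs.
From HB Require Import structures.
From mathcomp Require Import all_boot all_order all_fingroup all_algebra all_field.

Set Implicit Arguments.
Unset Strict Implicit.
Unset Printing Implicit Defensive.

Import GRing.Theory.
Local Open Scope ring_scope.

(** Since M is finitely generated projective over kG, it has a dual basis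
    (s_i, f_i): m = sum_i sum_g f_i(m g^-1) s_i g.  It shows that the map
    M^* (x) V^* -> (M (x) V)^* sending f (x) p to
    m (x) v |-> sum_g f(m g^-1) p(g v) is bijective, with inverse
    q |-> sum_i f_i (x) q(s_i (x) -).  With M ~ M^* this gives
    M (x) V^* ~ (M (x) V)^*, whence the direct implication.
    Conversely, M (x) V ~ M (x) V^*, and an equivalence reflects isomorphisms,
    once V^* is known to belong to B_G.  Let e be the identity of B_G and e' its
    image under g |-> g^-1.  As e acts trivially on M ~ M^*, so does e'; hence
    M (x) - sends the endomorphism e' of V to the identity, and so e' acts
    trivially on V, that is, e acts trivially on V^*. *)

(** * Lifting from a projective module over a direct factor *)

Section FixedSubmodule.
Variables (R : nzRingType) (e : R) (X : lmodType R).
Hypotheses (eC : forall r, r * e = e * r) (eI : e * e = e).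

Definition fixed_by : pred X := fun x => e *: x == x.

Lemma fixed_by_submod : submod_closed fixed_by.
Proof.
split=> [|r x y]; rewrite !unfold_in ?scaler0 //.
by move=> /eqP xe /eqP ye; rewrite scalerDr ye scalerA -eC -scalerA xe.
Qed.

HB.instance Definition _ := GRing.isSubmodClosed.Build R X fixed_by
  fixed_by_submod.

Record fixed_part :=
  FixedPart { fixed_val :> X; fixed_valP : fixed_by fixed_val }.

HB.instance Definition _ := [isSub for fixed_val].
HB.instance Definition _ := [Choice of fixed_part by <:].
HB.instance Definition _ := [SubChoice_isSubLmodule of fixed_part by <:].

(** [projective e P] provides lifts only into modules on which [e] is the identity, which free
    modules over the whole ring need not be. Since [e] is a central idempotent, its fixed points
    form a submodule of X, and [g] stays surjective on it: g(e x) = e g(x) = g(x). *)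
Lemma projective_lift (P : lmodType R) : projective e P ->
  forall Y : lmodType R, unital_at e Y ->
  forall (g : {linear X -> Y}) (f : {linear P -> Y}),
    (forall y, exists x, g x = y) ->
    exists h : {linear P -> X}, forall p, g (h p) = f p.
Proof.
move=> Pproj Y eY g f g_surj.
have eF : unital_at e (fixed_part : lmodType R).
  by move=> [x xe]; apply: val_inj; rewrite linearZ; apply/eqP.
have [y|h hP] := Pproj _ _ eF eY (g \o (val : {linear fixed_part -> X})) f.
  have [x <-] := g_surj y.
  have ex : fixed_by (e *: x) by rewrite /fixed_by scalerA eI.
  by exists (FixedPart ex); rewrite /= linearZ_LR eY.
by exists ((val : {linear fixed_part -> X}) \o h).
Qed.
End FixedSubmodule.

(** * Universal property of the tensor product *)

Section TensorLift.
Variables (k : fieldType) (S R : algType k) (M : bimod S R) (V : lmodType R).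

Lemma pure_tensorDl m n v :
  pure_tensor (m + n) v = pure_tensor m v + pure_tensor n v :> tensor M V.
Proof. by rewrite [RHS]tensor_addE; apply/tensor_ofP/tensor_Dl. Qed.

Lemma pure_tensorDr m v w :
  pure_tensor m (v + w) = pure_tensor m v + pure_tensor m w :> tensor M V.
Proof. by rewrite [RHS]tensor_addE; apply/tensor_ofP/tensor_Dr. Qed.

Lemma pure_tensor_bal m r v :
  pure_tensor (m <* r) v = pure_tensor m (r *: v) :> tensor M V.
Proof. exact/tensor_ofP/tensor_bal. Qed.

Lemma pure_tensorZ a m v :
  a *: pure_tensor m v = pure_tensor (a *: m) v :> tensor M V.
Proof. exact: tensor_scaleE. Qed.

Lemma pure_tensor0l v : pure_tensor 0 v = 0 :> tensor M V.
Proof. exact/tensor_ofP/tensor_0. Qed.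

Lemma pure_tensor0r m : pure_tensor m 0 = 0 :> tensor M V.
Proof. by apply: (addrI (pure_tensor m 0)); rewrite -pure_tensorDr !addr0. Qed.

Lemma pure_tensor_suml I (r : seq I) (F : I -> M) v :
  pure_tensor (\sum_(i <- r) F i) v =
    \sum_(i <- r) pure_tensor (F i) v :> tensor M V.
Proof.
exact: (big_morph (fun m => pure_tensor m v : tensor M V)
          (fun m n => pure_tensorDl m n v) (pure_tensor0l v)).
Qed.

Lemma pure_tensor_sumr I (r : seq I) m (F : I -> V) :
  pure_tensor m (\sum_(i <- r) F i) =
    \sum_(i <- r) pure_tensor m (F i) :> tensor M V.
Proof.
exact: (big_morph (fun v => pure_tensor m v : tensor M V)
          (pure_tensorDr m) (pure_tensor0r m)).
Qed.

(** Pure tensors span additively. Asking for additivity alone covers both S-linear maps and k-linear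
    forms on the tensor product. *)
Lemma tensor_additive_ext (W : zmodType) (f g : tensor M V -> W) :
  {morph f : x y / x + y} -> {morph g : x y / x + y} ->
  (forall m v, f (pure_tensor m v) = g (pure_tensor m v)) -> f =1 g.
Proof.
move=> fD gD fg; have morph0 (h : tensor M V -> W) :
    {morph h : x y / x + y} -> h 0 = 0.
  by move=> hD; apply: (addrI (h 0)); rewrite -hD !addr0.
elim/tensor_ind=> s; rewrite tensor_of_sum (big_morph f fD (morph0 f fD)).
by rewrite (big_morph g gD (morph0 g gD)); apply: eq_bigr => -[].
Qed.

Variables (W : zmodType) (b : M -> V -> W).
Hypotheses (bDl : forall m n v, b (m + n) v = b m v + b n v)
  (bDr : forall m v w, b m (v + w) = b m v + b m w)
  (bbal : forall m r v, b (m <* r) v = b m (r *: v)).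

Definition tensor_lift (x : tensor M V) : W :=
  \sum_(p <- generic_quotient.repr x) b p.1 p.2.

(** [tensor_lift] sums over a chosen representative word; the choice is harmless because the sum of
    [b] is invariant under every generating relation of [tensor_eq]. *)
Lemma tensor_lift_of s : tensor_lift (tensor_of s) = \sum_(p <- s) b p.1 p.2.
Proof.
suff E t : tensor_eq s t -> \sum_(p <- s) b p.1 p.2 = \sum_(p <- t) b p.1 p.2.
  exact/esym/E/tensor_sym/repr_tensor_of.
elim=> {s t} //=.
- by move=> s t u _ -> _ ->.
- by move=> s s' t t' _ es _ et; rewrite !big_cat es et.
- by move=> s t; rewrite !big_cat /= addrC.
- move=> v; rewrite big_nil big_seq1 /=.
  by apply: (addrI (b 0 v)); rewrite -bDl !addr0.
- by move=> m n v; rewrite !big_cons big_nil !addr0 bDl.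
- by move=> m v w; rewrite !big_cons big_nil !addr0 bDr.
- by move=> m r v; rewrite !big_seq1 bbal.
Qed.

Lemma tensor_lift_pure m v : tensor_lift (pure_tensor m v) = b m v.
Proof. by rewrite tensor_lift_of big_seq1. Qed.

Lemma tensor_liftD : {morph tensor_lift : x y / x + y}.
Proof.
elim/tensor_ind=> s; elim/tensor_ind=> t.
by rewrite [tensor_of s + _]tensor_addE !tensor_lift_of big_cat.
Qed.
End TensorLift.

Section TensorLiftLinear.
Variables (k : fieldType) (S R : algType k) (M : bimod S R) (V : lmodType R).
Variables (W : lmodType S) (b : M -> V -> W).
Hypotheses (bDl : forall m n v, b (m + n) v = b m v + b n v)
  (bDr : forall m v w, b m (v + w) = b m v + b m w)
  (bbal : forall m r v, b (m <* r) v = b m (r *: v))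
  (bZ : forall a m v, b (a *: m) v = a *: b m v).

Lemma tensor_lift_linear :
  exists f : {linear tensor M V -> W}, forall m v, f (pure_tensor m v) = b m v.
Proof.
have lin : linear (tensor_lift b : tensor M V -> W).
  move=> a x y; rewrite tensor_liftD //; congr (_ + _).
  elim/tensor_ind: x => s; rewrite [a *: _]tensor_scaleE !tensor_lift_of //.
  by rewrite big_map scaler_sumr; apply: eq_bigr => p _; apply: bZ.
pose f : {linear tensor M V -> W} := HB.pack (tensor_lift b : tensor M V -> W)
  (GRing.isLinear.Build S (tensor M V) W *:%R _ lin).
by exists f => m v; apply: tensor_lift_pure.
Qed.
End TensorLiftLinear.

(** * Isomorphisms of modules and of tensor products *)

Lemma bij_linear (R : pzRingType) (U V : lmodType R) (f : {linear U -> V}) :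
  bijective f -> exists g : {linear V -> U}, cancel f g /\ cancel g f.
Proof.
move=> [g fK gK].
have lin : linear g by move=> a x y; apply: (can_inj fK); rewrite linearP !gK.
pose h : {linear V -> U} := HB.pack g (GRing.isLinear.Build R V U *:%R g lin).
by exists h.
Qed.

Lemma lmod_iso_sym (R : pzRingType) (U V : lmodType R) :
  lmod_iso U V -> lmod_iso V U.
Proof. by move=> [f /bij_linear[g [fK gK]]]; exists g, f. Qed.

Lemma lmod_iso_trans (R : pzRingType) (U V W : lmodType R) :
  lmod_iso U V -> lmod_iso V W -> lmod_iso U W.
Proof. by move=> [f fb] [g gb]; exists (g \o f); apply: bij_comp. Qed.

Lemma tensor_iso_r (k : fieldType) (S R : algType k) (M : bimod S R)
    (V W : lmodType R) : lmod_iso V W -> lmod_iso (tensor M V) (tensor M W).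
Proof.
move=> [f /bij_linear[g [fK gK]]]; exists (tensor_map M f), (tensor_map M g).
  apply: tensor_additive_ext => [x y|//|m v]; first by rewrite !linearD.
  by rewrite /= !tensor_map_pure fK.
apply: tensor_additive_ext => [x y|//|m v]; first by rewrite !linearD.
by rewrite /= !tensor_map_pure gK.
Qed.

Lemma tensor_iso_l (k : fieldType) (S R : algType k) (M N : bimod S R)
    (V : lmodType R) : bimod_iso M N -> lmod_iso (tensor M V) (tensor N V).
Proof.
have lift (M1 M2 : bimod S R) (h : {linear M1 -> M2}) :
    (forall m r, h (m <* r) = h m <* r) ->
    exists F : {linear tensor M1 V -> tensor M2 V},
      forall m v, F (pure_tensor m v) = pure_tensor (h m) v.
  move=> hr; apply: tensor_lift_linear => [m n v|m v w|m r v|a m v].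
  - by rewrite linearD pure_tensorDl.
  - exact: pure_tensorDr.
  - by rewrite hr pure_tensor_bal.
  - by rewrite linearZ pure_tensorZ.
move=> [f [/bij_linear[g [fK gK]] fr]].
have gr m r : g (m <* r) = g m <* r by apply: (can_inj fK); rewrite fr !gK.
have [[F FE] [F' F'E]] := (lift _ _ f fr, lift _ _ g gr).
exists F, F'.
  apply: tensor_additive_ext => [x y|//|m v]; first by rewrite !linearD.
  by rewrite /= FE F'E fK.
apply: tensor_additive_ext => [x y|//|m v]; first by rewrite !linearD.
by rewrite /= F'E FE gK.
Qed.

(** * Coordinates in group algebras, bimodules and duals *)

Section GroupAlgebraTheory.
Variables (k : fieldType) (G : finGroupType).

Lemma galgE (a : galg k G) : a = \sum_g a g *: gelt k g.
Proof.
apply/ffunP=> x; rewrite sum_ffunE (bigD1 x) //= big1 => [|y /negPf yx].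
  by rewrite !ffunE eqxx [_ *: _]mulr1 addr0.
by rewrite !ffunE eq_sym yx [_ *: _]mulr0.
Qed.

(** The coefficient at 1 is the usual symmetrizing form of kG. As it recovers all coefficients from
    translates, a kG-linear map into kG is determined by one k-linear form. *)
Lemma galg_mul_geltV (a : galg k G) (g : G) : (a * gelt k g^-1%g) 1%g = a g.
Proof.
rewrite ffunE (bigD1 g) //= big1 => [|x /negPf xg].
  by rewrite ffunE mulg1 eqxx mulr1 addr0.
by rewrite ffunE mulg1 (inj_eq invg_inj) xg mulr0.
Qed.
End GroupAlgebraTheory.

Section RactTheory.
Variables (k : fieldType) (S R : algType k) (M : bimod S R).

Lemma ract_sum (m : M) I (r : seq I) (F : I -> R) :
  m <* (\sum_(i <- r) F i) = \sum_(i <- r) m <* F i.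
Proof.
apply: (big_morph _ (ractDr m)).
by apply: (addrI (m <* 0)); rewrite -ractDr !addr0.
Qed.

Lemma ract_scale (m : M) c (r : R) : m <* (c *: r) = c%:A *: (m <* r).
Proof. by rewrite -{1}[r]mul1r scalerAl ractM ract_scalar ractZ. Qed.
End RactTheory.

Section DualTheory.
Variables (k : fieldType) (G : finGroupType) (V : lmodType (galg k G)).

Lemma dual0 (f : dual V) : f 0 = 0.
Proof. by apply: (addrI (f 0)); rewrite -dualD !addr0. Qed.

Lemma dual_sum I (r : seq I) (F : I -> dual V) v :
  (\sum_(i <- r) F i) v = \sum_(i <- r) F i v.
Proof.
exact: (big_morph (fun f : dual V => f v) (fun f g => dual_addE f g v)).
Qed.

Lemma dual_scale_gelt c g (f : dual V) v :
  ((c *: gelt k g) *: f) v = c * f (gelt k g^-1%g *: v).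
Proof.
rewrite [LHS]dual_scaleE (bigD1 g) //= big1 => [|x /negPf xg].
  by rewrite !ffunE eqxx [_ *: _]mulr1 addr0.
by rewrite !ffunE xg [_ *: _]mulr0 mul0r.
Qed.
End DualTheory.

(** * Dual bases and the dual of a tensor product *)

Section DualTensor.
Variables (k : fieldType) (H G : finGroupType).
Variables (M : bimod (galg k H) (galg k G)) (V : lmodType (galg k G)).

Lemma dual_ract_scale_gelt (f : dual M) c g m :
  dual_ract f (c *: gelt k g) m = c * f (m <* gelt k g^-1%g).
Proof.
rewrite dual_ractE (bigD1 g) //= big1 => [|x /negPf xg].
  by rewrite !ffunE eqxx [_ *: _]mulr1 addr0.
by rewrite !ffunE xg [_ *: _]mulr0 mul0r.
Qed.

(** The usual dual basis of a right kG-module, with each kG-linear map M -> kG encoded by a k-linear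
    form f through m |-> sum_g f(m g^-1) g. *)
Definition dual_basis n (s : 'I_n -> M) (f : 'I_n -> dual M) : Prop :=
  forall m, m = \sum_(i < n) \sum_g
    (f i (m <* gelt k g^-1%g))%:A *: (s i <* gelt k g).

(** Finitely many generators give a surjection [g] from a free module onto M, and projectivity
    splits it: [h] lifts the identity of M. The coordinates of [h] are kG-linear maps M -> kG. *)
Lemma dual_basis_of_projective (e : galg k G) :
  (forall r, r * e = e * r) -> e * e = e ->
  progenerator (e : (galg k G)^c) (right_mod M) ->
  exists n (s : 'I_n -> M) (f : 'I_n -> dual M), dual_basis s f.
Proof.
move=> eC eI [eM [n [s sP]] Pproj _].
pose g0 (x : 'rV[(galg k G)^c]_n) : right_mod M :=
  \sum_i x 0 i *: (s i : right_mod M).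
have g_lin : linear g0.
  move=> a x y; rewrite /g0 scaler_sumr -big_split; apply: eq_bigr => i _ /=.
  by rewrite !mxE scalerDl scalerA.
pose g : {linear 'rV[(galg k G)^c]_n -> right_mod M} :=
  HB.pack g0 (GRing.isLinear.Build _ _ _ *:%R g0 g_lin).
have [||m|h hP] :=
  @projective_lift (galg k G)^c e 'rV_n _ _ _ Pproj _ eM g idfun.
- by move=> r; apply: (esym (eC r)).
- exact: eI.
- have [c cP] := sP m; exists (\row_i c i).
  by rewrite [RHS]cP; apply: eq_bigr => i _; rewrite mxE.
(* Only the coefficient at 1 is kept. By [hr] and [galg_mul_geltV], the coefficient of h(m)_i at g
   is f_i(m g^-1). *)
pose f0 i (m : restr M) : k^o := (h (m : right_mod M) 0 i : galg k G) 1%g.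
have hr (m : M) r i : h (m <* r : right_mod M) 0 i =
    (h (m : right_mod M) 0 i : galg k G) * r.
  have -> : (m <* r : right_mod M) =
    (r : (galg k G)^c) *: (m : right_mod M) by [].
  by rewrite linearZ mxE.
have f_lin i : linear (f0 i).
  move=> c m m'; rewrite /f0.
  have -> : (c *: m : restr M) = (m : M) <* c%:A by rewrite ract_scalar.
  have -> : h ((m : M) <* c%:A + m' : right_mod M) =
      h ((m : M) <* c%:A : right_mod M) + h m'.
    by rewrite linearD.
  by rewrite mxE hr ffunE -scalerAr mulr1 ffunE.
pose f i := Dual (HB.pack (f0 i)
    (GRing.isLinear.Build k (restr M) k^o *:%R (f0 i) (f_lin i))
  : {linear restr M -> k^o}).
exists n, s, f => m.
rewrite -[LHS](hP (m : right_mod M)); apply: eq_bigr => i _.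
rewrite [LHS](_ : _ = s i <* h (m : right_mod M) 0 i) //.
rewrite [in LHS](galgE (h _ _ _)) ract_sum; apply: eq_bigr => x _.
by rewrite ract_scale -galg_mul_geltV -hr.
Qed.

Section Pairing.
Variables (f : dual M) (p : dual V).

(** This is p(F(m) v), where F : M -> kG, m |-> sum_g f(m g^-1) g, is the right kG-linear map
    encoded by f. *)
Definition pairing (m : M) (v : V) : k^o :=
  \sum_g f (m <* gelt k g^-1%g) * p (gelt k g *: v).

Lemma pairingDl m n v : pairing (m + n) v = pairing m v + pairing n v.
Proof.
by rewrite -big_split; apply: eq_bigr => g _; rewrite ractDl dualD mulrDl.
Qed.

Lemma pairingDr m v w : pairing m (v + w) = pairing m v + pairing m w.
Proof.
by rewrite -big_split; apply: eq_bigr => g _; rewrite scalerDr dualD mulrDr.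
Qed.

Lemma pairingZl c m v : pairing (c%:A *: m) v = c * pairing m v.
Proof.
by rewrite big_distrr; apply: eq_bigr => g _ /=; rewrite ractZ dualZ mulrA.
Qed.

Lemma pairingZr c m v : pairing m (c%:A *: v) = c * pairing m v.
Proof.
rewrite big_distrr; apply: eq_bigr => g _ /=.
by rewrite galg_scaleC dualZ mulrCA.
Qed.

(** Translating the summation variable by g on the right moves g from m to v; [pairing_bal] extends
    this to kG by linearity. *)
Lemma pairing_gelt m g v :
  pairing (m <* gelt k g) v = pairing m (gelt k g *: v).
Proof.
rewrite /pairing (reindex_inj (mulIg g)); apply: eq_bigr => x _ /=.
by rewrite -ractM scalerA !geltM invMg mulKVg.
Qed.

Lemma pairing_bal m r v : pairing (m <* r) v = pairing m (r *: v).
Proof.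
have pair0 m' : pairing m' 0 = 0.
  by apply: (addrI (pairing m' 0)); rewrite -pairingDr !addr0.
have pair0l v' : pairing 0 v' = 0.
  by apply: (addrI (pairing 0 v')); rewrite -pairingDl !addr0.
rewrite [r]galgE ract_sum scaler_suml (big_morph _ (pairingDr m) (pair0 m)).
rewrite (big_morph (pairing^~ v) (fun m n => pairingDl m n v) (pair0l v)).
apply: eq_bigr => g _; rewrite ract_scale pairingZl pairing_gelt -pairingZr.
by rewrite scalerA -scalerAl mul1r.
Qed.

Lemma pairing_lift_linear :
  linear (tensor_lift pairing : restr (tensor M V) -> k^o).
Proof.
move=> c x y; rewrite [LHS](tensor_liftD pairingDl pairingDr pairing_bal).
congr (_ + _); elim/tensor_ind: x => s.
rewrite [c *: _](tensor_scaleE c%:A).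
rewrite !(tensor_lift_of pairingDl pairingDr pairing_bal) big_map scaler_sumr.
by apply: eq_bigr => q _; apply: pairingZl.
Qed.

Definition dual_pairing : dual (tensor M V) :=
  Dual (HB.pack (tensor_lift pairing : restr (tensor M V) -> k^o)
    (GRing.isLinear.Build k (restr (tensor M V)) k^o *:%R _ pairing_lift_linear)
    : {linear restr (tensor M V) -> k^o}).

Lemma dual_pairingE m v : dual_pairing (pure_tensor m v) = pairing m v.
Proof. exact: (tensor_lift_pure pairingDl pairingDr pairing_bal). Qed.
End Pairing.

Definition slice_fun (q : dual (tensor M V)) (m : M) : restr V -> k^o :=
  fun v => q (pure_tensor m v).

(** A scalar of k crosses the tensor sign by balancing, then passes from the right to the left
    action on M by [ract_scalar]. *)
Lemma slice_linear q m : linear (slice_fun q m).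
Proof.
move=> c v w; rewrite /slice_fun [c *: v]/GRing.scale /=.
by rewrite pure_tensorDr dualD -pure_tensor_bal ract_scalar -pure_tensorZ dualZ.
Qed.

Definition slice q m : dual V :=
  Dual (HB.pack (slice_fun q m)
    (GRing.isLinear.Build k (restr V) k^o *:%R _ (slice_linear q m))
    : {linear restr V -> k^o}).

Lemma dual_tensor n (s : 'I_n -> M) (f : 'I_n -> dual M) : dual_basis s f ->
  lmod_iso (tensor (dual_bimod M) (dual V)) (dual (tensor M V)).
Proof.
move=> sf.
have [p q r|p q r|p r q|a p q|F FE] :=
  @tensor_lift_linear k _ _ (dual_bimod M) (dual V) (dual (tensor M V)) dual_pairing.
- apply: dualP; apply: tensor_additive_ext => [x y|x y|m v]; rewrite ?dualD //.
  rewrite dual_addE !dual_pairingE -big_split; apply: eq_bigr => g _.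
  exact: mulrDl.
- apply: dualP; apply: tensor_additive_ext => [x y|x y|m v]; rewrite ?dualD //.
  rewrite dual_addE !dual_pairingE -big_split; apply: eq_bigr => g _.
  exact: mulrDr.
- apply: dualP; apply: tensor_additive_ext => [x y|x y|m v]; rewrite ?dualD //.
  rewrite !dual_pairingE /pairing.
  under eq_bigr do rewrite dual_ractE big_distrl /=.
  under [RHS]eq_bigr do rewrite dual_scaleE big_distrr /=.
  rewrite exchange_big [RHS]exchange_big; apply: eq_bigr => g _ /=.
  (* Here g runs over the group elements whose coefficients make up r. For fixed g, translating the
     other variable by g^-1 makes the two inner sums agree. *)
  rewrite (reindex_inj (mulgI g^-1%g)); apply: eq_bigr => x _ /=.
  by rewrite -ractM scalerA !geltM invMg invgK mulgK mulrCA mulrA.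
- apply: dualP; apply: tensor_additive_ext => [x y|x y|m v]; rewrite ?dualD //.
  rewrite dual_pairingE dual_scaleE.
  under [RHS]eq_bigr do rewrite pure_tensorZ dual_pairingE big_distrr /=.
  rewrite exchange_big; apply: eq_bigr => g _ /=.
  rewrite dual_scaleE big_distrl; apply: eq_bigr => x _ /=.
  by rewrite ractZ mulrA.
pose K (q : dual (tensor M V)) : tensor (dual_bimod M) (dual V) :=
  \sum_(i < n) pure_tensor (f i : dual_bimod M) (slice q (s i)).
exists F, K.
  apply: tensor_additive_ext => [x y|//|p q].
    rewrite linearD /K -big_split; apply: eq_bigr => i _ /=.
    by rewrite -pure_tensorDr; congr pure_tensor; apply: dualP.
  rewrite FE /K.
  (* Each slice is a kG-multiple of q. Its coefficients then cross the tensor sign onto [f i], and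
     the resulting sum of forms on M is p, by applying p to the dual basis expansion of m and
     substituting g^-1 for g. *)
  have slE i : slice (dual_pairing p q) (s i) =
      \sum_g (p (s i <* gelt k g^-1%g) *: gelt k g^-1%g : galg k G) *: q.
    apply: dualP => v; rewrite dual_sum [LHS]dual_pairingE.
    by apply: eq_bigr => g _; rewrite dual_scale_gelt invgK.
  under eq_bigr do rewrite slE pure_tensor_sumr.
  under eq_bigr do under eq_bigr do rewrite -pure_tensor_bal.
  under eq_bigr do rewrite -pure_tensor_suml.
  rewrite -pure_tensor_suml; congr pure_tensor; apply: dualP => m.
  rewrite dual_sum [in RHS](sf m) (big_morph p (dualD p) (dual0 p)).
  apply: eq_bigr => i _.
  rewrite dual_sum (big_morph p (dualD p) (dual0 p)).
  rewrite [RHS](reindex_inj invg_inj); apply: eq_bigr => g _ /=.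
  by rewrite dual_ract_scale_gelt dualZ mulrC.
(* Conversely, F(K q) at m (x) v expands to q applied to the dual basis expansion of m, tensored
   with v. *)
move=> q; apply: dualP.
apply: tensor_additive_ext => [x y|x y|m v]; rewrite ?dualD //.
rewrite linear_sum dual_sum [in RHS](sf m).
rewrite pure_tensor_suml (big_morph q (dualD q) (dual0 q)).
apply: eq_bigr => i _.
rewrite FE dual_pairingE pure_tensor_suml (big_morph q (dualD q) (dual0 q)).
apply: eq_bigr => g _.
by rewrite -pure_tensorZ dualZ pure_tensor_bal.
Qed.
End DualTensor.

(** * The antipode, block identities and equivalences of categories *)

Section Antipode.
Variables (k : fieldType) (G : finGroupType).

Definition antipode (a : galg k G) : galg k G := [ffun g => a g^-1%g].

Lemma antipodeK : involutive antipode.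
Proof. by move=> a; apply/ffunP=> x; rewrite !ffunE invgK. Qed.

Lemma antipodeM a b : antipode (a * b) = antipode b * antipode a.
Proof.
apply/ffunP=> x; rewrite !ffunE (reindex_inj (mulgI x^-1%g)) /=.
apply: eq_bigr => y _; rewrite !ffunE mulrC invMg invgK mulgK.
by rewrite invMg invgK.
Qed.

Lemma antipodeE a : antipode a = \sum_g a g *: gelt k g^-1%g.
Proof.
rewrite [LHS]galgE (reindex_inj invg_inj); apply: eq_bigr => g _.
by rewrite ffunE invgK.
Qed.

(** Reduces the action of a block identity on V^* to that of its antipode on V. *)
Lemma dual_scale_antipode (V : lmodType (galg k G)) a (f : dual V) v :
  (a *: f) v = f (antipode a *: v).
Proof.
rewrite [LHS]dual_scaleE antipodeE scaler_suml.
rewrite (big_morph f (dualD f) (dual0 f)).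
apply: eq_bigr => g _.
by rewrite -[X in _ = f ((_ *: X) *: _)]mul1r scalerAl -scalerA dualZ.
Qed.

Lemma dual_ract_antipode (H : finGroupType) (M : bimod (galg k H) (galg k G))
    (f : dual M) a m : dual_ract f a m = f (m <* antipode a).
Proof.
rewrite dual_ractE antipodeE ract_sum (big_morph f (dualD f) (dual0 f)).
by apply: eq_bigr => g _; rewrite ract_scale dualZ.
Qed.
End Antipode.

(** With e the identity of B, both r e and e r lie in the ideal B, so both equal e r e. *)
Lemma ideal_algid_central (k : fieldType) (A : falgType k) (B : {aspace A}) :
  two_sided_ideal B -> forall r : A, r * algid B = algid B * r.
Proof.
move=> /andP[BL BR] r; have eB := memv_algid B.
have reB : r * algid B \in B by apply/(subvP BL)/memv_mul; rewrite ?memvf.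
have erB : algid B * r \in B by apply/(subvP BR)/memv_mul; rewrite ?memvf.
by rewrite -[LHS](algidl reB) mulrA (algidr erB).
Qed.

(** An instance of faithfulness: naturality of [eta] at u reads eta_X = u eta_X once F u is the
    identity, and eta_X is invertible. *)
Lemma equivalence_reflects_id (C D : category) (F : functor C D) :
  is_equivalence F ->
  forall (X : C) (u : mor X X), fmap F u = Defs.idm (F X) -> u = Defs.idm X.
Proof.
move=> [K [[eta [eta_iso eta_nat]] _]] X u Fu.
have [t [_ et]] := eta_iso X.
have /= := eta_nat _ _ u; rewrite Fu fmap1 compm1 => E.
by rewrite -[u]compm1 -et compmA -E.
Qed.

(** Apply the quasi-inverse K to u and conjugate by the natural isomorphism [eta] from K F to the
    identity. *)
Lemma equivalence_reflects_iso (C D : category) (F : functor C D) :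
  is_equivalence F -> forall (X Y : C) (u : mor (F X) (F Y)), is_iso u ->
  exists v : mor X Y, is_iso v.
Proof.
move=> [K [[eta [eta_iso _]] _]] X Y u [w [wu uw]].
have [[s [se es]] [t [te et]]] := (eta_iso X, eta_iso Y).
exists (mcomp (eta Y) (mcomp (fmap K u) s)),
  (mcomp (eta X) (mcomp (fmap K w) t)).
split.
  rewrite -!compmA (compmA t) te comp1m (compmA (fmap K w)) -fmap_comp wu fmap1.
  by rewrite comp1m.
rewrite -!compmA (compmA s) se comp1m (compmA (fmap K u)) -fmap_comp uw fmap1.
by rewrite comp1m.
Qed.

(** * Transfer of self-duality in both directions *)

Theorem theoremA (k : fieldType) (G H : finGroupType)
    (BG : {aspace galg k G}) (BH : {aspace galg k H})
    (hBG : is_block BG) (hBH : is_block BH)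
    (M : bimod (galg k H) (galg k G))
    (hM : defines_morita (algid BH) (algid BG) M)
    (hMd : bimod_self_dual M)
    (V : lmodType (galg k G)) (hV : unital_at (algid BG) V) :
  self_dual V <-> self_dual (tensor M V).
Proof.
case: hBG hM => BGi _ _ [_ Mproj [eM equivM]].
have eC := ideal_algid_central BGi; set e := algid BG in eC Mproj equivM hV.
have eI : e * e = e by apply: algidl; apply: memv_algid.
have [n [s [f sf]]] := dual_basis_of_projective eC eI Mproj.
have dualMV : lmod_iso (tensor M (dual V)) (dual (tensor M V)).
  by apply: lmod_iso_trans (dual_tensor V sf); apply: tensor_iso_l.
split=> [VV|MV]; first by apply: lmod_iso_trans dualMV; apply: tensor_iso_r.
have aC r : r * antipode e = antipode e * r.
  by rewrite -[r]antipodeK -!antipodeM eC.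
(* Every q is h(m') with m' = h'(q), and m' e = m', so q e = q in M^* by right linearity of h. *)
have dual_anti (q : dual M) m : q (m <* antipode e) = q m.
  have [h [[h' hK h'K] hr]] := hMd; rewrite -(h'K q) -dual_ract_antipode.
  have [eMr _ _ _] := Mproj; congr (dual_fun _ m).
  by rewrite -[LHS]hr; congr (h _); apply: eMr.
(* Forms separate the points of M: the dual basis coefficients of both sides agree, since
   [antipode e] is central and can be moved past g^-1. *)
have M_anti (m : M) : m <* antipode e = m.
  rewrite [LHS]sf [RHS]sf; apply: eq_bigr => i _; apply: eq_bigr => g _.
  by rewrite -ractM -aC ractM dual_anti.
(* Centrality makes the action of [antipode e] an endomorphism u of V; balancing moves it onto M,
   where it is trivial, so M (x) u is the identity. *)
have V_anti (v : V) : antipode e *: v = v.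
  pose u0 (v : V) := antipode e *: v.
  have u_lin : linear u0.
    by move=> a x y; rewrite /u0 scalerDr !scalerA aC.
  pose X : umod_cat e := UMod hV.
  pose u : mor X X := HB.pack u0
    (GRing.isLinear.Build _ V V *:%R u0 u_lin) : {linear V -> V}.
  have : u = Defs.idm X.
    apply: (equivalence_reflects_id equivM); apply: linear_ext.
    apply: tensor_additive_ext => [x y|//|m w]; first by rewrite linearD.
    by rewrite [LHS]tensor_map_pure -pure_tensor_bal M_anti.
  by move=> /(congr1 (fun t : {linear V -> V} => t v)).
have hV' : unital_at e (dual V).
  by move=> p; apply: dualP => v; rewrite dual_scale_antipode V_anti.
(* The composite M (x) V -> (M (x) V)^* -> M (x) V^* is an isomorphism between images of objects of
   the block category, now that [hV'] makes V^* one. *)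
have [g /bij_linear[g' [gK g'K]]] := lmod_iso_trans MV (lmod_iso_sym dualMV).
pose X : umod_cat e := UMod hV; pose Y : umod_cat e := UMod hV'.
have [|v [w [wv vw]]] := @equivalence_reflects_iso _ _ _ equivM X Y g.
  by exists g'; split; apply: linear_ext.
exists v, w => x; first exact: (congr1 (fun t : {linear V -> V} => t x) wv).
exact: (congr1 (fun t : {linear dual V -> dual V} => t x) vw).
Qed.
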